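(* A finite graph $G$ is a PR-core if and only if it is an R-cocore.
   Context: Graphs are finite and undirected, loops allowed. For a finite set $B$ and a relation $R\subseteq V_G\times B$ with full image (every $b\in B$ has some $v$ with $(v,b)\in R$), $G\ast R$ is the graph with vertex set $B$ and edge set $\{(a,b)\in B\times B: \exists (u,v)\in E_G,\ (u,a)\in R,\ (v,b)\in R\}$. Write $G\leq^{PR}H$ if there is a relation $R\subseteq V_G\times V_H$ (not necessarily with full domain) with $G\ast R=H$. This is a quasi-order; $G$ is a PR-core if it has the minimum number of vertices among all graphs $H$ with $G\leq^{PR}H\leq^{PR}G$. For an induced subgraph $H$ of $G$, an R-coretraction of $H$ to $G$ is a relation $R\subseteq V_H\times V_G$ with $H\ast R=G$ and $(x,x)\in R$ for all $x\in V_H$; in this case $H$ is called an R-coretract of $G$. $G$ is an R-cocore if no proper induced subgraph of $G$ is an R-coretract of $G$. *)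

(* Defs.v *)
From mathcomp Require Import all_boot.
Set Implicit Arguments.
Unset Strict Implicit.
Unset Printing Implicit Defensive.

(* Not required to be irreflexive: loops are allowed. *)
Record graph := Graph {
  vert :> finType;
  edge : rel vert;
  edge_sym : symmetric edge }.

Definition full_image (A B : finType) (R : A -> B -> bool) : Prop :=
  forall b, exists a, R a b.

Definition star_edge (G : graph) (B : finType) (R : G -> B -> bool) : rel B :=
  fun a b => [exists u, exists v, [&& edge u v, R u a & R v b]].

Lemma star_edge_sym (G : graph) (B : finType) (R : G -> B -> bool) :
  symmetric (star_edge R).
Proof.
move=> a b; apply/existsP/existsP => -[u /existsP[v /and3P[e Ra Rb]]];
  by exists v; apply/existsP; exists u; rewrite edge_sym e Rb Ra.
Qed.

(* G * R.  The formula makes sense for every R; the requirement that R have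
   full image is imposed in [star_eq]. *)
Definition star (G : graph) (B : finType) (R : G -> B -> bool) : graph :=
  Graph (@star_edge_sym G B R).

(* "G * R is defined and equals H": both graphs have vertex set V_H, so
   equality (not isomorphism) means having the same edges. *)
Definition star_eq (G H : graph) (R : G -> H -> bool) : Prop :=
  full_image R /\ @edge (star R) =2 @edge H.

Definition PR_le (G H : graph) : Prop := exists R : G -> H -> bool, star_eq R.

(* The class of graphs H with G <= H <= G contains G itself, so G has the
   minimum number of vertices in it iff it has at most as many as each H. *)
Definition PR_core (G : graph) : Prop :=
  forall H : graph, PR_le G H -> PR_le H G -> #|G| <= #|H|.

Lemma induced_sym (G : graph) (A : {set G}) :
  symmetric (fun x y : {x : G | x \in A} => edge (val x) (val y)).
Proof. by move=> x y; apply: edge_sym. Qed.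

Definition induced (G : graph) (A : {set G}) : graph := Graph (@induced_sym G A).

(* Induced subgraphs of G are given by their vertex sets A; the inclusion of
   V_H = A into V_G is the subtype projection [val]. *)
Definition R_coretraction (G : graph) (A : {set G})
    (R : induced A -> G -> bool) : Prop :=
  star_eq R /\ forall x : {x : G | x \in A}, R x (val x).

Definition R_coretract (G : graph) (A : {set G}) : Prop :=
  exists R : induced A -> G -> bool, R_coretraction R.

Definition R_cocore (G : graph) : Prop :=
  forall A : {set G}, A \proper [set: G] -> ~ R_coretract A.

(* Main.v *)
Require Import Defs.
From mathcomp Require Import all_boot.

(** If G * R = H and H * S = G, some power E of the composite of R and S is an
    idempotent relation on V_G with G * E = G, and E factors through V_H.
    Every pair of E passes through a reflexive point of E, and any two reflexive
    points that factor through the same h in V_H are E-equivalent.  Keeping one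
    reflexive point for each h therefore gives an R-coretract with at most
    |V_H| vertices, so a cocore G cannot be larger than H. *)

Set Implicit Arguments.
Unset Strict Implicit.
Unset Printing Implicit Defensive.

Definition rel_comp (A B C : finType) (R : A -> B -> bool) (S : B -> C -> bool)
    : A -> C -> bool :=
  fun a c => [exists b, R a b && S b c].

Lemma rel_compP (A B C : finType) (R : A -> B -> bool) (S : B -> C -> bool) a c :
  reflect (exists2 b, R a b & S b c) (rel_comp R S a c).
Proof. exact: exists_inP. Qed.

Lemma star_edgeP (G : graph) (B : finType) (R : G -> B -> bool) a b :
  reflect (exists u v, [/\ edge u v, R u a & R v b]) (star_edge R a b).
Proof.
apply: (iffP existsP) => [[u /existsP[v /and3P[]]]|[u [v [uv ua vb]]]].
  by exists u, v.
by exists u; apply/existsP; exists v; apply/and3P.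
Qed.

(** The star operation is an action of composition, G * (R;S) = (G * R) * S, so powers of a relation
    fixing [G] fix [G] too. *)
Lemma star_eq_comp (G H K : graph) (R : G -> H -> bool) (S : H -> K -> bool) :
  star_eq R -> star_eq S -> star_eq (rel_comp R S).
Proof.
move=> [fR eR] [fS eS]; split=> [c|a b].
  have [h hc] := fS c; have [g gh] := fR h.
  by exists g; apply/rel_compP; exists h.
rewrite -eS; apply/star_edgeP/star_edgeP.
  move=> [u [v [uv /rel_compP[h uh ha] /rel_compP[k vk kb]]]].
  by exists h, k; split=> //; rewrite -eR; apply/star_edgeP; exists u, v.
move=> [h [k [hk ha kb]]].
move: hk; rewrite -eR => /star_edgeP[u [v [uv uh vk]]].
by exists u, v; split=> //; apply/rel_compP; [exists h | exists k].
Qed.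

Lemma eq_star_eq (G H : graph) (R S : G -> H -> bool) :
  R =2 S -> star_eq R -> star_eq S.
Proof.
move=> eRS [fR eR]; split=> [b|a b].
  by have [a ab] := fR b; exists a; rewrite -eRS.
rewrite -eR; apply/star_edgeP/star_edgeP=> -[u [v [uv ua vb]]];
  by exists u, v; rewrite ?eRS // -?eRS.
Qed.

Lemma PR_le_induced (G : graph) (A : {set G}) : PR_le G (induced A).
Proof.
exists (fun x y => x == val y); split=> [b|a b]; first by exists (val b).
apply/star_edgeP/idP => [[u [v [uv /eqP ua /eqP vb]]]|ab].
  by rewrite ua vb in uv.
by exists (val a), (val b).
Qed.

(** By pigeonhole two powers of [x] coincide, so the powers are eventually periodic. A late enough
    power whose exponent is a multiple of the period equals its own square. *)
Lemma idempotent_iter (T : finType) (op : T -> T -> T) (x : T) :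
  associative op -> exists k, let e := iter k (op x) x in op e e = e.
Proof.
move=> opA; pose p n := iter n (op x) x.
have pD m n : op (p m) (p n) = p (m + n).+1.
  by elim: m => [//|m IHm]; rewrite /= -opA IHm.
have [i [j [ltij eqij]]] : exists i j, i < j /\ p i = p j.
  have /injectivePn[a [b neq_ab eq_ab]] :
      ~~ injectiveb (fun a : 'I_#|T|.+1 => p a).
    apply/injectiveP=> /leq_card; by rewrite card_ord ltnn.
  by case: (ltngtP a b) => [lt|gt|/val_inj eq];
    [exists a, b | exists b, a | rewrite eq eqxx in neq_ab].
have per1 n : i <= n -> p (n + (j - i)) = p n.
  move=> lein; rewrite -{2}(subnKC lein) addnBA ?(ltnW ltij) //.
  rewrite -addnBAC // addnC.
  by rewrite /p addnC iterD -[iter j _ _]/(p j) -eqij -iterD addnC.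
have per q n : i <= n -> p (n + q * (j - i)) = p n.
  move=> lein; elim: q => [|q IHq]; first by rewrite addn0.
  by rewrite mulSn addnCA addnC per1 // (leq_trans lein) ?leq_addr.
have pos : 0 < i.+1 * (j - i) by rewrite muln_gt0 subn_gt0.
(* Since [p n] is the power with exponent n + 1, the index is one less than a multiple of the
   period; the factor [i.+1] brings it to at least [i]. *)
exists (i.+1 * (j - i)).-1; rewrite -[iter _ _ _]/(p _) /= pD -addnS.
rewrite prednK // per //.
by rewrite -ltnS prednK // leq_pmulr // subn_gt0.
Qed.

(** Finite functions encode relations as elements of a finite type with extensional equality, as
    [idempotent_iter] requires. *)
Definition ffrel (T : finType) (f : {ffun T -> {ffun T -> bool}}) : rel T :=
  fun x y => f x y.

Definition ffrel_comp (T : finType) (f g : {ffun T -> {ffun T -> bool}}) :=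
  [ffun x => [ffun y => rel_comp (ffrel f) (ffrel g) x y]].

Lemma ffrel_compE (T : finType) (f g : {ffun T -> {ffun T -> bool}}) :
  ffrel (ffrel_comp f g) =2 rel_comp (ffrel f) (ffrel g).
Proof. by move=> x y; rewrite /ffrel !ffunE. Qed.

Lemma ffrel_compA (T : finType) : associative (@ffrel_comp T).
Proof.
move=> f g h; apply/ffunP=> x; apply/ffunP=> y; rewrite -!/(ffrel _ x y).
rewrite !ffrel_compE; apply/rel_compP/rel_compP => -[z].
  rewrite ffrel_compE => xz /rel_compP[w zw wy]; exists w => //.
  by rewrite ffrel_compE; apply/rel_compP; exists z.
rewrite ffrel_compE => /rel_compP[w xw wz] zy; exists w => //.
by rewrite ffrel_compE; apply/rel_compP; exists z.
Qed.

Lemma idempotent_reflexive_point (T : finType) (E : rel T) :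
  rel_comp E E =2 E ->
  forall x y, E x y -> exists z, [/\ E x z, E z z & E z y].
Proof.
move=> EE x y xy.
have tE b a c : E a b -> E b c -> E a c.
  by move=> ab bc; rewrite -EE; apply/rel_compP; exists b.
move: (xy); rewrite -EE => /rel_compP[z0 xz0 z0y].
have Pz0 : E x z0 && E z0 y by rewrite xz0.
(* A point with the fewest E-successors is reflexive: an intermediate point w
   after it has the same successors, hence lies among its own. *)
case: (@arg_minnP _ z0 (fun z => E x z && E z y) (fun z => #|E z|) Pz0) => z.
case/andP=> xz zy zmin.
move: (zy); rewrite -EE => /rel_compP[w zw wy].
have sub : E w \subset E z by apply/subsetP=> v; apply: tE.
have le_zw : #|E z| <= #|E w| by apply: zmin; rewrite wy (tE _ _ _ xz zw).
have /subset_cardP/(_ sub) eqE : #|E w| = #|E z|.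
  by apply/eqP; rewrite eqn_leq le_zw subset_leq_card.
exists w; split=> //; first exact: tE xz zw.
by have := eqE w; rewrite !unfold_in zw.
Qed.

(** The coretraction is [E] with its source cut down to [A]. Interpolating in [A] moves the ends of
    an edge into [A], and the new ends are adjacent because G * E = G. *)
Lemma idempotent_R_coretract (G : graph) (E : G -> G -> bool) (A : {set G}) :
  rel_comp E E =2 E -> star_eq E -> {in A, forall x, E x x} ->
  (forall x y, E x y -> exists2 z, z \in A & E x z /\ E z y) ->
  R_coretract A.
Proof.
move=> EE [fE eE] reflA interp; exists (fun x y => E (val x) y).
split; last by move=> x; apply: reflA (valP x).
split=> [b|a b].
  have [x xb] := fE b; have [z zA [_ zb]] := interp _ _ xb.
  by exists (Sub z zA).
rewrite -[RHS]eE; apply/star_edgeP/star_edgeP=> -[u [v [uv ua vb]]].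
  by exists (val u), (val v).
have [u' u'A [uu' u'a]] := interp _ _ ua.
have [v' v'A [vv' v'b]] := interp _ _ vb.
exists (Sub u' u'A), (Sub v' v'A); split=> //=.
by rewrite -eE; apply/star_edgeP; exists u, v.
Qed.

Lemma idempotent_factor (G H : graph) : PR_le G H -> PR_le H G ->
  exists (E : G -> G -> bool) (R : G -> H -> bool) (S : H -> G -> bool),
  [/\ star_eq E, rel_comp E E =2 E & E =2 rel_comp R S].
Proof.
move=> [R RGH] [S SHG].
pose t := [ffun x => [ffun y => rel_comp R S x y]].
have tE : ffrel t =2 rel_comp R S by move=> x y; rewrite /ffrel !ffunE.
have [k /= idem] := idempotent_iter t (@ffrel_compA G).
pose p n := ffrel (iter n (ffrel_comp t) t).
have pS n : p n.+1 =2 rel_comp (ffrel t) (p n) by apply: ffrel_compE.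
have st : star_eq (ffrel t).
  by apply: eq_star_eq (star_eq_comp RGH SHG) => x y; rewrite tE.
have sp n : star_eq (p n).
  elim: n => [//|n IHn].
  by apply: eq_star_eq (star_eq_comp st IHn) => x y; rewrite pS.
have [S' pS'] : exists S', p k =2 rel_comp R S'.
  (* Every power of R;S starts with [R]; by associativity the rest is a relation from [H] to [G]. *)
  case: (k) => [|n]; first by exists S.
  exists (rel_comp S (p n)) => x y; rewrite pS.
  apply/rel_compP/rel_compP => [[z]|[h xh /rel_compP[z hz zy]]].
    rewrite tE => /rel_compP[h xh hz] zy; exists h => //.
    by apply/rel_compP; exists z.
  by exists z => //; rewrite tE; apply/rel_compP; exists h.
by exists (p k), R, S'; split=> // x y; rewrite -ffrel_compE idem.
Qed.

Lemma small_R_coretract (G H : graph) : PR_le G H -> PR_le H G ->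
  exists2 A : {set G}, #|A| <= #|H| & R_coretract A.
Proof.
move=> GH HG; have [E [R [S [sE EE ERS]]]] := idempotent_factor GH HG.
pose P h z := R z h && S h z.
(* [pick] is a function of [h], so [A] has at most one point for each [h]. *)
pose A := [set z | [exists h, [pick z | P h z] == Some z]].
have AP z : z \in A -> exists2 h, P h z & [pick z | P h z] = Some z.
  rewrite inE => /existsP[h /eqP pz]; exists h => //.
  by move: pz; case: pickP => // w Pw [<-].
exists A.
  have sA : [set Some z | z in A] \subset [set [pick z | P h z] | h : H].
    apply/subsetP=> _ /imsetP[z /AP[h _ pz] ->].
    by apply/imsetP; exists h.
  rewrite -(card_imset A (@Some_inj _)) (leq_trans (subset_leq_card sA)) //.
  exact: leq_imset_card.
have EI h x y : R x h -> S h y -> E x y.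
  by move=> xh hy; rewrite ERS; apply/rel_compP; exists h.
apply: (idempotent_R_coretract EE sE) => [x /AP[h /andP[xh hx] _]|x y xy].
  exact: EI xh hx.
have [w [xw ww wy]] := idempotent_reflexive_point EE xy.
(* The loop at [w] passes through some [h]; the point [z] chosen for this [h] is [E]-related to [w]
   both ways and can replace it. *)
move: ww; rewrite ERS => /rel_compP[h wh hw].
case pz: [pick z | P h z] => [z|]; last first.
  by move: pz; case: pickP => // /(_ w); rewrite /P wh hw.
have zA : z \in A by rewrite inE; apply/existsP; exists h; rewrite pz.
have /andP[zh hz] : P h z by move: pz; case: pickP => // v Pv [<-].
exists z => //; split; rewrite -EE; apply/rel_compP; exists w => //.
  exact: EI wh hz.
exact: EI zh hw.
Qed.

Theorem theorem5p9p3 (G : graph) : PR_core G <-> R_cocore G.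
Proof.
split=> [coreG A ltA [R [RG _]]|cocoreG H GH HG].
  (* A coretract lies both above and below [G], so minimality forbids a proper one. *)
  have := coreG (induced A) (PR_le_induced A) (ex_intro _ R RG).
  by rewrite card_sig leqNgt -cardsT proper_card.
have [A leAH retA] := small_R_coretract GH HG.
rewrite leqNgt; apply/negP=> ltHG; apply: (cocoreG A) retA.
by rewrite properEcard subsetT cardsT (leq_ltn_trans leAH ltHG).
Qed.
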